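(* Let $f\in\mathcal H_E$. Then $$\|f\|_{\mathcal H_E}^2=\frac12\left(\int_V\big(P(f^2)-P(f)^2\big)\,d\nu+\int_V(P(f)-f)^2\,d\nu\right)=\frac12\left(\int_V\big(P(f^2)-P(f)^2\big)\,d\nu+\|f-P(f)\|_{L^2(\nu)}^2\right).$$ In particular, the integrals on the right-hand side are finite and non-negative. Moreover, $$\mathrm{Var}_x(f\circ X_1)=P(f^2)(x)-P(f)^2(x)\ge 0,$$ and $x\mapsto \mathrm{Var}_x(f\circ X_1)$ belongs to $L^1(\nu)$ for any $f\in\mathcal H_E$; hence, equivalently, $$\|f\|^2_{\mathcal H_E}=\frac12\left(\big\|\mathrm{Var}_x(f\circ X_1)\big\|_{L^1(\nu)}+\big\|\big(\mathbb E_x(f\circ X_0-f\circ X_1)\big)^2\big\|_{L^1(\nu)}\right).$$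
   Context: Setting. $(V,\mathcal B)$ is an uncountable standard Borel space, $\mu$ a non-atomic $\sigma$-finite positive Borel measure on it. $\rho$ is a $\sigma$-finite positive measure on $(V\times V,\mathcal B\times\mathcal B)$ which is symmetric, $\rho(A\times B)=\rho(B\times A)$ for all $A,B\in\mathcal B$, and which disintegrates as $\rho(f)=\int_V\int_V f(x,y)\,d\rho_x(y)\,d\mu(x)$ for a measurable field of measures $x\mapsto\rho_x$. Assumption 1: $c(x):=\rho_x(V)$ satisfies $0<c(x)<\infty$ for $\mu$-a.e. $x$ and $\int_A c\,d\mu<\infty$ whenever $\mu(A)<\infty$. The measure $\rho$ is irreducible: for the kernels $k^1(x,A)=\rho_x(A)$, $k^n(x,A)=\int_V k^{n-1}(y,A)\,\rho_x(dy)$, for every $A$ with $\mu(A)>0$ and $\mu$-a.e. $x$ there is $n$ with $k^n(x,A)>0$. Put $d\nu=c\,d\mu$, $P(x,dy)=c(x)^{-1}d\rho_x(y)$, $P(f)(x)=\int_V f(y)P(x,dy)$; $P(f)^2$ means $(P(f))^2$. Energy space. $\mathcal H_E$ is the space of Borel functions $f:V\to\mathbb R$ with $\iint(f(x)-f(y))^2\,d\rho<\infty$, functions differing by a constant being identified, with norm $\|f\|^2_{\mathcal H_E}=\frac12\iint_{V\times V}(f(x)-f(y))^2\,d\rho(x,y)$. Assumption 2: functions in $\mathcal H_E$ satisfy $\int_A f^2\,d\mu<\infty$ whenever $\mu(A)<\infty$. Path space. On $\Omega=V^{\{0,1,2,\dots\}}$ let $X_n(\omega)=\omega_n$ and let $\mathbb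 P_x$ be the law of the Markov chain with transition probabilities $P(\cdot,\cdot)$ started at $X_0=x$; $\mathbb E_x$ is the expectation and $\mathrm{Var}_x$ the variance with respect to $\mathbb P_x$, so that $\mathbb E_x(f\circ X_0)=f(x)$ and $\mathbb E_x(f\circ X_1)=P(f)(x)$. *)

(* Defs.v *)
From HB Require Import structures.
From mathcomp Require Import all_boot all_order all_algebra.
From mathcomp Require Import all_classical all_reals all_analysis.
From mathcomp Require Import measurable_realfun.

Set Implicit Arguments.
Unset Strict Implicit.
Unset Printing Implicit Defensive.

Import Order.TTheory GRing.Theory Num.Theory.
Import numFieldNormedType.Exports.

Local Open Scope classical_set_scope.
Local Open Scope ring_scope.
Local Open Scope ereal_scope.

(* A Borel isomorphism onto a Polish space [Y]; a Hausdorff pseudometric space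
   is a metric space. *)
Definition standard_borel (R : realType) (d : measure_display)
    (V : measurableType d) : Prop :=
  exists Y : completePseudoMetricType R,
    [/\ hausdorff_space Y, @second_countable Y &
        exists2 phi : V -> Y, bijective phi &
          forall B : set V,
            measurable B <-> (<<s [set U : set Y | open U] >>) (phi @` B)].

Definition non_atomic (R : realType) (d : measure_display)
    (V : measurableType d) (mu : {measure set V -> \bar R}) : Prop :=
  forall A : set V, measurable A -> 0 < mu A ->
    exists B : set V, [/\ measurable B, B `<=` A & 0 < mu B < mu A].

Definition symmetric_measure (R : realType) (d : measure_display)
    (V : measurableType d) (rho : {measure set (V * V) -> \bar R}) : Prop :=
  forall A B : set V, measurable A -> measurable B ->
    rho (A `*` B) = rho (B `*` A).

Section Kernel.
Context (R : realType) (d : measure_display) (V : measurableType d).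
Variables (mu : {measure set V -> \bar R}) (rho_ : R.-ker V ~> V).

Definition disintegration (rho : {measure set (V * V) -> \bar R}) : Prop :=
  forall F : V * V -> \bar R, measurable_fun [set: V * V] F -> (forall z, 0 <= F z) ->
    \int[rho]_z F z = \int[mu]_x \int[rho_ x]_y F (x, y).

Definition cfun (x : V) : \bar R := rho_ x setT.

Definition locally_finite_cfun : Prop :=
  {ae mu, forall x, 0 < cfun x < +oo} /\
  (forall A : set V, measurable A -> mu A < +oo ->
    \int[mu]_(x in A) cfun x < +oo).

(* [kpow n] is the kernel k^(n+1), so that [exists n, 0 < kpow n x A] ranges
   over the exponents n >= 1. *)
Fixpoint kpow (n : nat) (x : V) (A : set V) : \bar R :=
  if n is m.+1 then \int[rho_ x]_y kpow m y A else rho_ x A.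

Definition irreducible_kernel : Prop :=
  forall A : set V, measurable A -> 0 < mu A ->
    {ae mu, forall x, exists n : nat, 0 < kpow n x A}.

(* P(x, dy) = c(x)^-1 rho_x(dy) as soon as 0 < c(x) < +oo. At the remaining
   points, which form a [mu]-null set under [locally_finite_cfun], this formula
   does not define a probability and P(x, -) is taken to be the Dirac mass
   at x. *)
Definition transition (x : V) : probability V R := mnormalize (rho_ x) \d_x.

Definition Pop (f : V -> R) (x : V) : \bar R := \int[transition x]_y (f y)%:E.

Definition nu (A : set V) : \bar R := \int[mu]_(x in A) cfun x.

Let nu0 : nu set0 = 0.
Proof. exact: integral_set0. Qed.

Let nu_ge0 A : 0 <= nu A.
Proof. exact: integral_ge0. Qed.

Let nu_sigma_additive : semi_sigma_additive nu.
Proof.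
move=> F mF tF mUF; rewrite /nu ge0_integral_bigcup//.
- apply: is_cvg_ereal_nneg_natsum_cond => n _ _; exact: integral_ge0.
- exact: measurable_funTS (measurable_kernel rho_ setT measurableT).
Qed.

HB.instance Definition _ := isMeasure.Build _ _ _ nu
  nu0 nu_ge0 nu_sigma_additive.

End Kernel.

Section EnergySpace.
Context (R : realType) (d : measure_display) (V : measurableType d).
Variable rho : {measure set (V * V) -> \bar R}.

Definition energy (f : V -> R) : \bar R :=
  \int[rho]_z ((f z.1 - f z.2) ^+ 2)%:E.

(* Representatives of the elements of H_E: membership and norm do not change
   when a constant is added to the function. *)
Definition HE : set (V -> R) :=
  [set f | measurable_fun setT f /\ energy f < +oo].

Definition HE_norm (f : V -> R) : R := Num.sqrt (2^-1 * fine (energy f)).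

Definition HE_locally_L2 (mu : {measure set V -> \bar R}) : Prop :=
  forall f : V -> R, HE f -> forall A : set V, measurable A -> mu A < +oo ->
    \int[mu]_(x in A) ((f x) ^+ 2)%:E < +oo.

End EnergySpace.

Section PathSpace.
Context (R : realType) (d : measure_display) (V : measurableType d).

Definition path_space :=
  g_sigma_algebraType
    (\bigcup_n preimage_set_system setT (fun w : nat -> V => w n) measurable).

Definition X (n : nat) (w : path_space) : V := (w : nat -> V) n.

(* [Q] is the law of the chain with transition probabilities [P] started at
   [x]; these equations determine [Q]. *)
Definition markov_law (P : V -> probability V R) (x : V)
    (Q : probability path_space R) : Prop :=
  (forall A : set V, measurable A -> Q (X 0 @^-1` A) = \d_x A) /\
  (forall (n : nat) (A : nat -> set V) (B : set V),
    (forall i, measurable (A i)) -> measurable B ->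
    let C := \bigcap_(i in `I_n.+1) (X i @^-1` A i) in
    Q (C `&` X n.+1 @^-1` B) = \int[Q]_(w in C) P (X n w) B).

End PathSpace.

(* Main.v *)
(** Disintegrating [rho] over its first marginal, which is [nu], gives
    [energy f = \int[nu]_x D x] where [D x] is the second moment of [f x - f y]
    under the probability P(x, dy). Hence [D x] is finite for almost every [x],
    so that [f] is square integrable for P(x, -), and the decomposition of a
    second moment into a variance and a squared mean reads
    [D x = (P (f ^ 2) x - (P f x) ^ 2) + (f x - P f x) ^ 2]. Both terms are
    nonnegative, so they can be integrated separately. The path space only
    enters through the laws of [X 0] and [X 1], namely the Dirac mass at [x]
    and P(x, -). *)

Require Import Defs.
From HB Require Import structures.
From mathcomp Require Import all_boot all_order all_algebra.
From mathcomp Require Import all_classical all_reals all_analysis.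
From mathcomp Require Import measurable_realfun.

Set Implicit Arguments.
Unset Strict Implicit.
Unset Printing Implicit Defensive.

Import Order.TTheory GRing.Theory Num.Theory.
Import numFieldNormedType.Exports.
Local Open Scope classical_set_scope.
Local Open Scope ring_scope.
Local Open Scope ereal_scope.

(** * The transition probabilities as a kernel *)

Section TransitionKernel.
Context (R : realType) (d : measure_display) (V : measurableType d).
Variable rho_ : R.-ker V ~> V.

Let c := cfun rho_.

Lemma measurable_cfun : measurable_fun setT c.
Proof. exact: measurable_kernel. Qed.

Definition regular_points : set V := [set x | 0 < c x < +oo].

Lemma measurable_regular_points : measurable regular_points.
Proof.
rewrite (_ : regular_points = [set x | c x != 0] `&` [set x | c x != +oo]).
  by apply: measurableI; exact: kernel_measurable_neq_cst.
apply/seteqP; split => x /=; rewrite /regular_points /= lt0e lt_neqAle leey.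
  by case/andP => /andP[-> _] /andP[->].
by case=> -> ->; rewrite measure_ge0.
Qed.

(* [transition] as a measure-valued constant, to carry the kernel structure. *)
Definition ktransition (x : V) : {measure set V -> \bar R} := transition rho_ x.

Let measurable_ktransition U : measurable U ->
  measurable_fun [set: V] (ktransition ^~ U).
Proof.
move=> mU.
(* [knormalize] falls back on one fixed measure, whereas [transition] falls back on the Dirac mass
   at the moving point [x]. The kernel is therefore glued from two measurable pieces along the event
   that [c x] is zero or infinite. *)
have -> : ktransition ^~ U = fun x => if (c x == 0) || (c x == +oo)
    then \d_x U else knormalize rho_ \d_point x U.
  apply/funext => x.
  rewrite /ktransition /transition /knormalize /= /mnormalize.
  by rewrite /c /cfun; case: ifPn.
apply: measurable_fun_if => //.
- by apply: measurable_or => //; exact: kernel_measurable_fun_eq_cst.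
- exact/measurable_funTS/(measurable_kernel (kdirac (@measurable_id _ _ setT))).
- exact/measurable_funTS/(measurable_kernel (knormalize rho_ \d_point)).
Qed.

HB.instance Definition _ :=
  isKernel.Build _ _ _ _ R ktransition measurable_ktransition.

Let ktransition1 x : ktransition x [set: V] = 1.
Proof. exact: probability_setT. Qed.

HB.instance Definition _ :=
  Kernel_isProbability.Build _ _ _ _ _ ktransition ktransition1.

Lemma measurable_transition (U : set V) : measurable U ->
  measurable_fun [set: V] (fun x => transition rho_ x U).
Proof. exact: (measurable_kernel ktransition). Qed.

Lemma measurable_fun_integral_transition (k : V * V -> \bar R) :
  measurable_fun setT k ->
  measurable_fun setT (fun x => \int[transition rho_ x]_y k (x, y)).
Proof.
move=> mk.
rewrite (_ : (fun x => _) = (fun x => \int[ktransition x]_y k^\+ (x, y) -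
    \int[ktransition x]_y k^\- (x, y))).
  apply: emeasurable_funB.
  - apply: (measurable_fun_integral_finite_kernel k^\+ ktransition) => //.
    exact: measurable_funepos.
  - apply: (measurable_fun_integral_finite_kernel k^\- ktransition) => //.
    exact: measurable_funeneg.
apply/funext => x; rewrite -[LHS]/(\int[ktransition x]_y (k \o pair x) y).
by rewrite integralE funepos_comp funeneg_comp.
Qed.

(** Undoes the normalisation: at a regular point [rho_ x] and [c x] times the probability agree on
    every measurable set. *)
Lemma ge0_integral_kernel_transition (x : V) (h : V -> \bar R) :
  regular_points x -> measurable_fun setT h -> (forall y, 0 <= h y) ->
  \int[rho_ x]_y h y = c x * \int[transition rho_ x]_y h y.
Proof.
move=> /andP[c0 coo] mh h0.
have cfin : c x \is a fin_num by rewrite ge0_fin_numE// ltW.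
have k0 : (0 <= fine (c x))%R by rewrite fine_ge0// ltW.
transitivity (\int[mscale (NngNum k0) (transition rho_ x)]_y h y); last first.
  by rewrite ge0_integral_mscale//= fineK.
apply: eq_measure_integral => A mA _.
transitivity ((fine (c x))%:E * transition rho_ x A) => //.
rewrite /transition/= /mnormalize -/(cfun rho_ x) -/c gt_eqF//= lt_eqF//=.
by rewrite muleCA -EFinM mulfV ?mule1// gt_eqF// fine_gt0// c0.
Qed.

End TransitionKernel.

(** * Disintegration of [rho] over [nu] *)

Section FirstMarginal.
Context (R : realType) (d : measure_display) (V : measurableType d).
Variables (mu : {measure set V -> \bar R}) (rho_ : R.-ker V ~> V).
Hypothesis c_gt0_fin : {ae mu, forall x, 0 < cfun rho_ x < +oo}.

(** The density [c] of [nu] is positive [mu]-almost everywhere, so a set on which it integrates to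
    zero is [mu]-null. The other direction is absolute continuity. *)
Lemma ae_nu (Q : set V) :
  {ae nu mu rho_, forall x, Q x} <-> {ae mu, forall x, Q x}.
Proof.
have mc := measurable_cfun rho_.
split=> -[N [mN N0 QN]].
- have /ae_eq_integral_abs : \int[mu]_(x in N) `|cfun rho_ x| = 0.
    rewrite -[RHS]N0; apply: eq_integral => x _.
    by rewrite gee0_abs// measure_ge0.
  move=> /(_ mN (measurable_funTS mc)) cN.
  move: c_gt0_fin cN; apply: filterS2 => x /andP[c0 _] cNx.
  apply: contrapT => /QN /cNx /= c0'.
  by rewrite c0' ltxx in c0.
- exists N; split => //; apply: null_set_integral => //.
  exact: measurable_funTS.
Qed.

Variable rho : {measure set (V * V) -> \bar R}.
Hypothesis rho_dis : disintegration mu rho_ rho.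

(* By [rho_dis], [nu] is the first marginal of [rho]. *)
Lemma ge0_integral_nu (g : V -> \bar R) :
  measurable_fun setT g -> (forall x, 0 <= g x) ->
  \int[nu mu rho_]_x g x = \int[rho]_z g z.1.
Proof.
move=> mg g0.
rewrite -[RHS]/(\int[rho]_(z in fst @^-1` setT) (g \o fst) z).
rewrite -(ge0_integral_pushforward measurable_fst)//.
apply: eq_measure_integral => A mA _.
have mA1 : measurable (fst @^-1` A : set (V * V)).
  by rewrite -[X in measurable X]setTI; exact: measurable_fst.
(* The indicator of the cylinder over [A] is constant in the second variable, so its inner integral
   is [c x] on [A] and zero elsewhere. *)
transitivity (\int[rho]_z (\1_(fst @^-1` A) z)%:E); last first.
  by rewrite integral_indic// setIT.
rewrite rho_dis//; last exact/measurable_EFinP.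
rewrite -[LHS]/(\int[mu]_(x in A) cfun rho_ x) integral_mkcond.
apply: eq_integral => x _.
transitivity (\int[rho_ x]_y cst (\1_A x)%:E y) => //.
by rewrite integral_cst// /patch indicE; case: ifP; rewrite ?mul1e ?mul0e.
Qed.

(** At a regular point, integrating either [F (x, -)] or the constant [D x] against [rho_ x] gives
    [c x * D x]. Hence [F] and [D \o fst] have the same [rho]-integral, and the latter is an
    integral over the first marginal. *)
Lemma disintegration_nu (F : V * V -> \bar R) :
  measurable_fun setT F -> (forall z, 0 <= F z) ->
  \int[rho]_z F z = \int[nu mu rho_]_x \int[transition rho_ x]_y F (x, y).
Proof.
move=> mF F0.
pose D x := \int[transition rho_ x]_y F (x, y).
have mD : measurable_fun setT D := measurable_fun_integral_transition rho_ mF.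
have D0 x : 0 <= D x by exact: integral_ge0.
pose G := regular_points rho_.
have mG : measurable G := measurable_regular_points rho_.
(* The irregular points are [nu]-null, so the cylinder over them is [rho]-null. *)
have aeG : {ae rho, forall z, G z.1}.
  have [N [mN N0 GN]] := (ae_nu G).2 c_gt0_fin.
  exists (fst @^-1` N); split.
  - by rewrite -[X in measurable X]setTI; exact: measurable_fst.
  - have mN1 : measurable (fst @^-1` N : set (V * V)).
      by rewrite -[X in measurable X]setTI; exact: measurable_fst.
    transitivity (\int[rho]_z (\1_N z.1)%:E).
      by rewrite -[LHS](congr1 _ (setIT _)) -integral_indic.
    rewrite -(@ge0_integral_nu (EFin \o \1_N)).
    + by rewrite [LHS]integral_indic// setIT.
    + exact/measurable_EFinP.
    + by move=> x; rewrite lee_fin.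
  - by move=> z; exact: GN.
(* [rho_] need not be s-finite, so [x |-> \int[rho_ x]_y H (x, y)] may fail to
   be measurable and must not be changed on a null set; once [H] is cut off
   outside [G], the integrands compared below agree everywhere. *)
have restrict (H : V * V -> \bar R) : measurable_fun setT H ->
    (forall z, 0 <= H z) ->
    \int[rho]_z H z = \int[mu]_x \int[rho_ x]_y (H (x, y) * (\1_G x)%:E).
  move=> mH H0.
  have mH' : measurable_fun setT (fun z : V * V => H z * (\1_G z.1)%:E).
    apply: emeasurable_funM => //; apply/measurable_EFinP.
    exact: measurableT_comp (measurable_indic mG) measurable_fst.
  have H'0 z : 0 <= H z * (\1_G z.1)%:E by rewrite mule_ge0// lee_fin.
  rewrite -(rho_dis mH' H'0); apply: ge0_ae_eq_integral => //.
  by apply: filterS aeG => z Gz _; rewrite indicE mem_set// mule1.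
have mD1 : measurable_fun setT (D \o @fst V V).
  exact: measurableT_comp mD measurable_fst.
rewrite (ge0_integral_nu mD D0) (restrict F)//.
rewrite (restrict _ mD1 (fun z => D0 z.1))//.
apply: eq_integral => x _; rewrite indicE.
have [Gx|Gx] := pselect (G x); last first.
  rewrite memNset//.
  under eq_integral do rewrite mule0.
  by under [RHS]eq_integral do rewrite mule0.
rewrite mem_set//.
under eq_integral do rewrite mule1; under [RHS]eq_integral do rewrite mule1.
have mFx : measurable_fun setT (fun y => F (x, y)).
  exact: measurableT_comp mF (measurable_pair1 _).
by rewrite (ge0_integral_kernel_transition Gx mFx)//
  -[RHS]/(\int[rho_ x]_y cst (D x) y) integral_cst// muleC.
Qed.

End FirstMarginal.

(** * Second moments about an arbitrary point *)

Section Variance.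
Context (R : realType) (d : measure_display) (T : measurableType d).
Variable Q : probability T R.

Lemma measurable_Lfun2 (g : T -> R) : measurable_fun setT g ->
  \int[Q]_y ((g y) ^+ 2)%:E < +oo -> g \in Lfun Q 2%:E.
Proof.
move=> mg g2.
apply/andP; split; rewrite inE//=; rewrite /finite_norm unlock poweR_lty//.
by under eq_integral do rewrite poweR_EFin powR_mulrn// real_normK ?num_real//.
Qed.

(** Constants are square integrable for a probability, so [g] inherits square integrability from
    [a - g]. The reflection [a - g] has the variance of [g], and its second moment is variance plus
    squared mean. *)
Lemma integral_sqr_dist (g : T -> R) (a : R) : measurable_fun setT g ->
  \int[Q]_y ((a - g y) ^+ 2)%:E < +oo ->
  g \in Lfun Q 2%:E /\
  \int[Q]_y ((a - g y) ^+ 2)%:E = 'V_Q[g] + (a%:E - 'E_Q[g]) ^+ 2.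
Proof.
move=> mg ag.
have h2 : (cst a \- g)%R \in Lfun Q 2%:E.
  by apply: measurable_Lfun2 => //; exact: measurable_funB.
have g2 : g \in Lfun Q 2%:E.
  have -> : g = (cst a - (cst a \- g))%R.
    by apply/funext => y; rewrite !fctE opprB addrC subrK.
  by apply: rpredB => [|?|?]; rewrite ?lee1n ?Lfun_cst.
split => //.
have g1 : g \in Lfun Q 1 by rewrite Lfun_subset12 ?fin_num_measure.
have <- : 'V_Q[(cst a \- g)%R] = 'V_Q[g] by exact: varianceB_cst_l.
have <- : 'E_Q[(cst a \- g)%R] = a%:E - 'E_Q[g].
  by rewrite expectationB ?Lfun_cst// expectation_cst.
(* A finite mean allows its square to be subtracted and added back. *)
have Efin : 'E_Q[(cst a \- g)%R] \is a fin_num.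
  by rewrite expectation_fin_num// Lfun_subset12 ?fin_num_measure.
by rewrite varianceE// subeK ?fin_numX// unlock.
Qed.

End Variance.

(** The integrals of the positive and negative parts agree one by one, hence so does their
    difference, even if it is infinite or of the form oo - oo. *)
Lemma integral_law (R : realType) (d1 d2 : measure_display)
    (T1 : measurableType d1) (T2 : measurableType d2) (phi : T1 -> T2)
    (Q : {measure set T1 -> \bar R}) (m : {measure set T2 -> \bar R})
    (h : T2 -> \bar R) :
  measurable_fun setT phi -> measurable_fun setT h ->
  (forall A, measurable A -> Q (phi @^-1` A) = m A) ->
  \int[Q]_w h (phi w) = \int[m]_y h y.
Proof.
move=> mphi mh Qm.
have pos (g : T2 -> \bar R) : measurable_fun setT g -> (forall y, 0 <= g y) ->
    \int[Q]_w g (phi w) = \int[m]_y g y.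
  move=> mg g0.
  rewrite -[LHS]/(\int[Q]_(w in phi @^-1` setT) (g \o phi) w).
  rewrite -(ge0_integral_pushforward mphi)//.
  by apply: eq_measure_integral => A mA _; exact: Qm.
rewrite -[LHS]/(\int[Q]_w (h \o phi) w) integralE funepos_comp funeneg_comp.
rewrite [RHS]integralE; congr (_ - _); apply: pos => //.
- exact: measurable_funepos.
- exact: measurable_funeneg.
Qed.

(** * The first two coordinates of the chain *)

Section FirstSteps.
Context (R : realType) (d : measure_display) (V : measurableType d).

Lemma measurable_coordinate n : measurable_fun setT (@X d V n).
Proof.
move=> _ A mA; rewrite setTI; apply: sub_sigma_algebra.
by exists n => //; exists A => //; rewrite setTI.
Qed.

Variables (rho_ : R.-ker V ~> V) (x : V) (Q : probability (path_space V) R).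
Hypothesis Q_law : markov_law (transition rho_) x Q.

Lemma integral_X0 (h : V -> \bar R) : measurable_fun setT h ->
  \int[Q]_w h (X 0 w) = h x.
Proof.
move=> mh; rewrite (@integral_law _ _ _ _ _ _ _ \d_x)//.
- by rewrite integral_dirac// diracT mul1e.
- exact: measurable_coordinate.
- by case: Q_law.
Qed.

Lemma law_X1 (B : set V) : measurable B ->
  Q (X 1 @^-1` B) = transition rho_ x B.
Proof.
(* With [n = 0] and full sets [A i], the cylinder is the whole path space, and the Markov equation
   averages P(-, B) over the law of [X 0]. *)
move=> mB; have := Q_law.2 0%N (fun=> setT) B (fun=> measurableT) mB.
set C := \bigcap_(i in _) _; have -> : C = setT by apply/seteqP; split.
rewrite /= setTI => ->.
exact: (integral_X0 (measurable_transition rho_ mB)).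
Qed.

Lemma integral_X1 (h : V -> \bar R) : measurable_fun setT h ->
  \int[Q]_w h (X 1 w) = \int[transition rho_ x]_y h y.
Proof.
move=> mh; apply: integral_law => //; first exact: measurable_coordinate.
exact: law_X1.
Qed.

Lemma ae_X0 (A : set V) : measurable A -> A x -> {ae Q, forall w, A (X 0 w)}.
Proof.
move=> mA Ax; exists (X 0 @^-1` (~` A)); split => //.
- rewrite -[X in measurable X]setTI; apply: measurable_coordinate => //.
  exact: measurableC.
- case: Q_law => -> //; last exact: measurableC.
  by rewrite diracE memNset.
Qed.

Variable f : V -> R.
Hypothesis mf : measurable_fun setT f.

Let mf_coord n : measurable_fun setT (f \o @X d V n).
Proof. by apply: measurableT_comp => //; exact: measurable_coordinate. Qed.

Lemma expectation_X1 : 'E_Q[f \o X 1] = 'E_(transition rho_ x)[f].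
Proof.
rewrite unlock; apply: (integral_X1 (h := EFin \o f)).
exact/measurable_EFinP.
Qed.

Lemma variance_X1 : 'V_Q[f \o X 1] = 'V_(transition rho_ x)[f].
Proof.
rewrite /variance !covariance.unlock expectation_X1.
(* The means already agree, so both variances integrate the same square, centred at the constant
   [m]. *)
set m := fine _; rewrite expectation.unlock.
apply: (integral_X1 (h := fun y => ((f y - m) * (f y - m))%:E)).
apply/measurable_EFinP.
by apply: measurable_funM; exact: measurable_funB.
Qed.

Lemma expectation_X0_X1 :
  'E_Q[(f \o X 0) \- (f \o X 1)] = 'E_(transition rho_ x)[cst (f x) \- f].
Proof.
rewrite unlock.
transitivity (\int[Q]_w (f x - f (X 1 w))%:E).
  apply: ae_eq_integral => //.
  - by apply/measurable_EFinP; exact: measurable_funB.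
  - by apply/measurable_EFinP; apply: measurable_funB => //; exact: mf_coord.
  (* The level set of [f] through [x] is measurable because singletons of the real line are; [X 0]
     lies in it almost surely. *)
  - have : {ae Q, forall w, (f @^-1` [set f x]) (X 0 w)}.
      by apply: ae_X0 => //; rewrite -[X in measurable X]setTI; exact: mf.
    by apply: filterS => w /= -> _.
apply: (integral_X1 (h := fun y => (f x - f y)%:E)).
by apply/measurable_EFinP; exact: measurable_funB.
Qed.

End FirstSteps.

(** Translates between the powers inside [Lnorm] and plain squares. The infinite cases matter, since
    [P f x] may be infinite where [f] is not integrable. *)
Lemma poweR2_abs (R : realType) (x : \bar R) : `|x| `^ 2 = x ^+ 2.
Proof.
case: x => [r| |].
- by rewrite abse_EFin poweR_EFin powR_mulrn// real_normK ?num_real// EFin_expe.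
- by rewrite -[LHS]/(+oo `^ 2) poweRyr// ?pnatr_eq0// expe2 mulyy.
- by rewrite -[LHS]/(+oo `^ 2) poweRyr// ?pnatr_eq0// expe2 mulNyNy.
Qed.

Lemma HE_norm_sqr (R : realType) (d : measure_display) (V : measurableType d)
    (rho : {measure set (V * V) -> \bar R}) (f : V -> R) : HE rho f ->
  ((HE_norm rho f) ^+ 2)%:E = (2^-1)%:E * energy rho f.
Proof.
move=> [_ foo].
have e0 : 0 <= energy rho f.
  by apply: integral_ge0 => z _; rewrite lee_fin sqr_ge0.
rewrite /HE_norm sqr_sqrtr ?mulr_ge0 ?fine_ge0 ?invr_ge0//.
by rewrite EFinM fineK// ge0_fin_numE.
Qed.

(** * Measurability of one-step means and variances in the starting point *)

Section OneStepStatistics.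
Context (R : realType) (d : measure_display) (V : measurableType d).
Variables (rho_ : R.-ker V ~> V) (f : V -> R).
Hypothesis mf : measurable_fun setT f.

Lemma Pop_expectation (g : V -> R) (x : V) :
  Pop rho_ g x = 'E_(transition rho_ x)[g].
Proof. by rewrite expectation.unlock. Qed.

Lemma measurable_Pop (g : V -> R) : measurable_fun setT g ->
  measurable_fun setT (Pop rho_ g).
Proof.
move=> mg.
apply: (measurable_fun_integral_transition rho_ (k := fun z => (g z.2)%:E)).
by apply/measurable_EFinP; exact: measurableT_comp mg measurable_snd.
Qed.

Lemma measurable_sqr_dist :
  measurable_fun setT (fun z : V * V => ((f z.1 - f z.2) ^+ 2)%:E).
Proof.
apply/measurable_EFinP/measurable_funX/measurable_funB.
  exact: measurableT_comp mf measurable_fst.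
exact: measurableT_comp mf measurable_snd.
Qed.

Lemma measurable_variance_transition :
  measurable_fun setT (fun x => 'V_(transition rho_ x)[f]).
Proof.
pose m x := fine (Pop rho_ f x).
rewrite (_ : (fun x => _) = (fun x => \int[transition rho_ x]_y
    ((f y - m x) * (f y - m x))%:E)); last first.
  apply/funext => x.
  by rewrite /variance covariance.unlock -Pop_expectation expectation.unlock.
(* The centre [m x] moves with [x], so the integrand is viewed as a function of the pair. *)
have mm : measurable_fun setT (fun z : V * V => f z.2 - m z.1)%R.
  apply: measurable_funB; first exact: measurableT_comp mf measurable_snd.
  apply: measurableT_comp measurable_fst.
  by apply: measurableT_comp (measurable_Pop mf).
apply: (measurable_fun_integral_transition rho_
  (k := fun z => ((f z.2 - m z.1) * (f z.2 - m z.1))%:E)).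
by apply/measurable_EFinP; exact: measurable_funM.
Qed.

Lemma measurable_expectation_increment :
  measurable_fun setT (fun x => 'E_(transition rho_ x)[cst (f x) \- f]).
Proof.
rewrite expectation.unlock.
apply: (measurable_fun_integral_transition rho_
  (k := fun z => (f z.1 - f z.2)%:E)).
apply/measurable_EFinP/measurable_funB.
  exact: measurableT_comp mf measurable_fst.
exact: measurableT_comp mf measurable_snd.
Qed.

End OneStepStatistics.

(** * The energy identity and its probabilistic form *)

Theorem theorem5p8 (R : realType) (d : measure_display) (V : measurableType d)
  (mu : {sigma_finite_measure set V -> \bar R})
  (rho : {sigma_finite_measure set (V * V)%type -> \bar R})
  (rho_ : R.-ker V ~> V)
  (Pr : V -> probability (path_space V) R)
  (V_borel : standard_borel R V)
  (V_unctbl : ~ countable [set: V])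
  (mu_na : non_atomic mu)
  (rho_sym : symmetric_measure rho)
  (rho_dis : disintegration mu rho_ rho)
  (assumption1 : locally_finite_cfun mu rho_)
  (rho_irr : irreducible_kernel mu rho_)
  (assumption2 : HE_locally_L2 rho mu)
  (Pr_law : forall x : V, markov_law (transition rho_) x (Pr x))
  (f : V -> R) (f_HE : HE rho f) :
  let P := Pop rho_ in
  let f2 := fun y : V => (f y ^+ 2)%R in
  let I1 := \int[nu mu rho_]_x (P f2 x - P f x ^+ 2) in
  let I2 := \int[nu mu rho_]_x (P f x - (f x)%:E) ^+ 2 in
  let Var := fun x : V => 'V_(Pr x)[f \o X 1] in
  let E01sq := fun x : V => 'E_(Pr x)[(f \o X 0) \- (f \o X 1)] ^+ 2 in
  let normsq := ((HE_norm rho f) ^+ 2)%:E in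
  [/\ normsq = (2^-1)%:E * (I1 + I2),
      normsq = (2^-1)%:E *
        (I1 + ('N[nu mu rho_]_2%:E[(fun x => (f x)%:E - P f x)]) ^+ 2),
      0 <= I1 < +oo /\ 0 <= I2 < +oo,
      {ae mu, forall x, Var x = P f2 x - P f x ^+ 2 /\ 0 <= Var x} &
      (nu mu rho_).-integrable setT Var /\
      normsq = (2^-1)%:E *
        ('N[nu mu rho_]_1[Var] + 'N[nu mu rho_]_1[E01sq])].
Proof.
move=> P f2 I1 I2 Var E01sq normsq.
have [mf f_fin] := f_HE.
have aec := assumption1.1.
set n := nu mu rho_.
pose D x := \int[transition rho_ x]_y ((f x - f y) ^+ 2)%:E.
pose v x := 'V_(transition rho_ x)[f].
pose b x := ((f x)%:E - P f x) ^+ 2.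
have mv : measurable_fun setT v := measurable_variance_transition rho_ mf.
have mP : measurable_fun setT (P f) := measurable_Pop rho_ mf.
have mPf2 : measurable_fun setT (P f2).
  by apply: measurable_Pop; exact: measurable_funX.
have mPf : measurable_fun setT (fun x => (f x)%:E - P f x).
  by apply: emeasurable_funB => //; exact/measurable_EFinP.
have mb : measurable_fun setT b by exact: emeasurable_funM.
have v0 x : 0 <= v x by exact: variance_ge0.
have b0 x : 0 <= b x by exact: sqre_ge0.
have mD : measurable_fun setT D.
  exact: measurable_fun_integral_transition (measurable_sqr_dist mf).
have D0 x : 0 <= D x by apply: integral_ge0 => y _; rewrite lee_fin sqr_ge0.
have energyD : energy rho f = \int[n]_x D x.
  apply: (disintegration_nu aec rho_dis (measurable_sqr_dist mf)) => z.
  by rewrite lee_fin sqr_ge0.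
have aeD : {ae n, forall x, D x < +oo}.
  have /(integrable_ae measurableT) : n.-integrable setT D.
    apply/integrableP; split => //.
    under eq_integral do rewrite gee0_abs//.
    by rewrite -energyD.
  by apply: filterS => x /(_ I); rewrite ge0_fin_numE.
have ae_L2 : {ae n, forall x, f \in Lfun (transition rho_ x) 2%:E}.
  by apply: filterS aeD => x Dx; have [] := integral_sqr_dist mf Dx.
(* Where [f] is not square integrable the right-hand side may read oo - oo, so the identity is
   claimed almost everywhere only. *)
have aev : {ae n, forall x, v x = P f2 x - P f x ^+ 2}.
  apply: filterS ae_L2 => x fx.
  by rewrite /v varianceE// /P !Pop_expectation.
have aeE : {ae n, forall x,
    'E_(transition rho_ x)[cst (f x) \- f] = (f x)%:E - P f x}.
  apply: filterS ae_L2 => x fx.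
  have f1 : f \in Lfun (transition rho_ x) 1.
    by rewrite Lfun_subset12 ?fin_num_measure.
  by rewrite expectationB ?Lfun_cst// expectation_cst /P Pop_expectation.
have VarE x : Var x = v x := variance_X1 (Pr_law x) mf.
have I1E : I1 = \int[n]_x v x.
  apply: ae_eq_integral => //.
    by apply: emeasurable_funB => //; exact: emeasurable_funM.
  by apply: filterS aev => x ->.
(* This identity is pointwise: [f x] is finite, so the difference can be negated inside the square
   even if [P f x] is infinite. *)
have I2E : I2 = \int[n]_x b x.
  apply: eq_integral => x _.
  by rewrite /b !expe2 -muleNN fin_num_oppeB// addeC.
have energyE : energy rho f = I1 + I2.
  rewrite I1E I2E energyD -ge0_integralD//.
  apply: ge0_ae_eq_integral => //.
  - exact: emeasurable_funD.
  - by move=> x _; rewrite adde_ge0.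
  - apply: filterS aeD => x Dx _.
    by have [_] := integral_sqr_dist mf Dx; rewrite -Pop_expectation.
have I10 : 0 <= I1 by rewrite I1E integral_ge0.
have I20 : 0 <= I2 by rewrite I2E integral_ge0.
have normE : normsq = (2^-1)%:E * (I1 + I2).
  by rewrite /normsq HE_norm_sqr// energyE.
have I1oo : I1 < +oo by rewrite (le_lt_trans _ f_fin)// energyE leeDl.
have I2oo : I2 < +oo by rewrite (le_lt_trans _ f_fin)// energyE leeDr.
have NVar : 'N[n]_1[Var] = I1.
  rewrite Lnorm1 I1E; apply: eq_integral => x _.
  by rewrite VarE gee0_abs.
split => //.
- rewrite normE; congr (_ * (_ + _)).
  rewrite -poweR2_abs gee0_abs ?Lnorm_ge0// poweR_Lnorm//.
  by rewrite I2E; apply: eq_integral => x _; rewrite poweR2_abs.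
- by rewrite I10 I1oo I20 I2oo.
(* The identity holds [nu]-almost everywhere and passes to [mu] because the null sets coincide. *)
- apply/(ae_nu aec); apply: filterS aev => x vx.
  by rewrite VarE vx -vx.
split.
  apply/integrableP; split; first by rewrite (_ : Var = v)//; exact/funext.
  by rewrite -Lnorm1 NVar.
rewrite NVar normE; congr (_ * (_ + _)).
(* By linearity the mean increment is [f x - P f x] wherever [f] is square integrable, so the two
   integrands agree almost everywhere. *)
rewrite Lnorm1 I2E; apply: ge0_ae_eq_integral => //.
- rewrite (_ : (fun x => _) = (fun x =>
      'E_(transition rho_ x)[cst (f x) \- f] ^+ 2)); last first.
    apply/funext => x.
    by rewrite gee0_abs ?sqre_ge0// /E01sq (expectation_X0_X1 (Pr_law x) mf).
  by apply: emeasurable_funM; exact: measurable_expectation_increment.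
- apply: filterS aeE => x Ex _.
  by rewrite gee0_abs ?sqre_ge0// /E01sq (expectation_X0_X1 (Pr_law x) mf) Ex.
Qed.
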